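(* Let $\mathcal T\in\mathbb R^{n^{\times d}}_{ps,+}$. Then $$\log\rho(\mathcal T)=\max_{p=(p_1,\ldots,p_n)^\top\in\Pi_n}\ \inf_{x>0}\ \sum_{i=1}^n p_i\log\frac{\mathcal T(x)_i}{x_i^{d-1}},$$ where the infimum is over all $x=(x_1,\dots,x_n)^\top\in\mathbb R^n$ with all entries positive.
   Context: Let $n\ge1$, $d\ge3$ be integers, $[n]=\{1,\dots,n\}$. $\mathbb R^{n^{\times d}}_{ps,+}$ is the set of tensors $\mathcal T=[t_{i_1,\dots,i_d}]$, $i_1,\dots,i_d\in[n]$, with nonnegative real entries symmetric in the last $d-1$ indices. For $x\in\mathbb C^n$, $\mathcal T(x)_i=\sum_{i_2,\dots,i_d\in[n]}t_{i,i_2,\dots,i_d}x_{i_2}\cdots x_{i_d}$, and $x^{\circ p}=(x_1^p,\dots,x_n^p)^\top$. An eigenvalue of $\mathcal T$ is $\lambda\in\mathbb C$ with $\mathcal T(x)=\lambda x^{\circ(d-1)}$ for some nonzero $x\in\mathbb C^n$; $\rho(\mathcal T)$ is the maximum modulus of the eigenvalues. $\Pi_n\subset\mathbb R^n_+$ is the set of probability vectors. Conventions: $\log0=-\infty$, $0\cdot\log0=0$, $t\log0=-\infty$ for $t>0$; the value $-\infty$ is allowed on both sides. *)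

(* Defs.v *)
From mathcomp Require Import all_boot all_order all_algebra all_fingroup.
From mathcomp Require Import all_classical all_reals all_analysis.
From mathcomp Require Import complex.

Set Implicit Arguments.
Unset Strict Implicit.
Unset Printing Implicit Defensive.

Import Order.TTheory GRing.Theory Num.Theory.
Local Open Scope classical_set_scope.
Local Open Scope ring_scope.

(* [T i f] is the entry t_(i, f 0, ..., f (d - 2)): the first index is kept
   apart from the block of the last d - 1 indices. *)
Definition tensor (K : Type) (n d : nat) : Type :=
  'I_n -> {ffun 'I_d.-1 -> 'I_n} -> K.

Definition partially_symmetric (K : Type) (n d : nat) (T : tensor K n d) : Prop :=
  forall (i : 'I_n) (f : {ffun 'I_d.-1 -> 'I_n}) (s : 'S_d.-1),
    T i [ffun k => f (s k)] = T i f.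

Definition nonneg_tensor (R : realType) (n d : nat) (T : tensor R n d) : Prop :=
  forall (i : 'I_n) (f : {ffun 'I_d.-1 -> 'I_n}), 0 <= T i f.

Definition tensor_apply (K : comNzRingType) (n d : nat) (T : tensor K n d)
    (x : 'cV[K]_n) : 'cV[K]_n :=
  \col_i \sum_(f : {ffun 'I_d.-1 -> 'I_n}) T i f * \prod_(k < d.-1) x (f k) 0.

Definition hadamard_pow (K : comNzRingType) (n p : nat) (x : 'cV[K]_n) : 'cV[K]_n :=
  \col_i x i 0 ^+ p.

Definition complex_tensor (R : realType) (n d : nat) (T : tensor R n d) :
    tensor R[i] n d :=
  fun i f => ((T i f)%:C)%C.

Definition tensor_eigenvalue (R : realType) (n d : nat) (T : tensor R n d)
    (l : R[i]) : Prop :=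
  exists2 x : 'cV[R[i]]_n, x != 0 &
    tensor_apply (complex_tensor T) x = l *: hadamard_pow d.-1 x.

Definition is_max disp (E : porderType disp) (A : set E) (m : E) : Prop :=
  A m /\ ubound A m.

(* The norm of R[i] takes its values in R[i], hence the embedding of r. *)
Definition is_spectral_radius (R : realType) (n d : nat) (T : tensor R n d)
    (rho : R) : Prop :=
  is_max [set r : R | exists2 l : R[i],
            tensor_eigenvalue T l & `|l| = (r%:C)%C] rho.

Definition probability_vectors (R : realType) (n : nat) : set 'cV[R]_n :=
  [set p | (forall i, 0 <= p i 0) /\ \sum_i p i 0 = 1].
Arguments probability_vectors : clear implicits.

Definition positive_vectors (R : realType) (n : nat) : set 'cV[R]_n :=
  [set x | forall i, 0 < x i 0].
Arguments positive_vectors : clear implicits.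

(* [lne] sends 0 to -oo, and the product of \bar R satisfies 0 * -oo = 0 and
   t * -oo = -oo for t > 0; no term of the sum is +oo. *)
Definition log_growth (R : realType) (n d : nat) (T : tensor R n d)
    (p x : 'cV[R]_n) : \bar R :=
  (\sum_(i < n) (p i 0)%:E * lne (tensor_apply T x i 0 / x i 0 ^+ d.-1)%:E)%E.

(* Main.v *)
Require Import Defs.
From mathcomp Require Import all_boot all_order all_algebra all_fingroup.
From mathcomp Require Import all_classical all_reals all_analysis.
From mathcomp Require Import complex.
From mathcomp Require Import ring lra.
Local Open Scope classical_set_scope.
Local Open Scope ring_scope.

Set Implicit Arguments.
Unset Strict Implicit.
Unset Printing Implicit Defensive.

Import Order.TTheory GRing.Theory Num.Theory.
Import numFieldNormedType.Exports.

(* Let F be the polynomial map of T, homogeneous of degree m = d - 1, and let rho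
   be the Collatz-Wielandt number, i.e. the infimum of max_i F(x)_i / x_i^m over
   x > 0.  Comparing the moduli of an eigenvector with a positive x shows that
   every eigenvalue has modulus at most rho.  The perturbation
   F_e(x) = F(x) + e (x_1 + ... + x_n)^m attains its Collatz-Wielandt number at a
   positive eigenvector v; as e tends to 0, the normalised v accumulate at an
   eigenvector of F for rho.

   In the coordinates log x the functions log (F_e(x)_i / x_i^m) are convex, and at
   log v the gradient of the i-th one is a_i - m e_i, where the rows a_i are
   nonnegative with sum m.  If p is a probability vector with p a = m p (again an
   eigenvector of a monotone map, of degree 1), then the average with weights p is
   convex and critical at log v, so v minimises it.  A limit of such p as e tends
   to 0 is optimal for F; logarithms are replaced by weighted products there, so
   that vanishing F(x)_i cause no trouble. *)

(** * Limits of bounded sequences along an ultrafilter *)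

(** Such an ultrafilter replaces the extraction of subsequences: all coordinates of a bounded
    sequence of vectors converge along it at once. *)
Lemma ultra_oo : exists2 G : set_system nat, UltraFilter G & \oo `<=` G.
Proof. by have [G [? ?]] := ultraFilterLemma eventually_filter; exists G. Qed.

Lemma ultra_bounded_cvg (R : realType) (G : set_system nat) (u : nat -> R) (a b : R) :
  UltraFilter G -> (forall k, a <= u k <= b) ->
  exists2 l, a <= l <= b & u k @[k --> G] --> l.
Proof.
move=> GU uab.
have [|l [lab Hl]] := @segment_compact R a b (u @ G).
  apply: (@filterS _ G _ setT); last exact: filterT.
  by move=> k _; rewrite /= in_itv /= uab.
exists l; first by move: lab; rewrite /= in_itv.
(* A cluster point of an ultrafilter is a limit: otherwise the complement of some neighbourhood [A]
   belongs to the ultrafilter and would have to meet [A]. *)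
move=> A lA; have [//|GA] := in_ultra_setVsetC (u @^-1` A) GU.
by have [z []] := Hl _ A (GA : (u @ G) (~` A)) lA.
Qed.

Lemma sum1_le1 (R : realType) (I : finType) (x : I -> R) j :
  (forall i, 0 <= x i) -> \sum_i x i = 1 -> x j <= 1.
Proof. by move=> x0 <-; rewrite (bigD1 j)//= lerDl sumr_ge0. Qed.

Section Cvg.
Context {R : realType} {G : set_system nat} {FG : ProperFilter G}.

Lemma cvg_sum_fin (J : finType) (f : J -> nat -> R) (a : J -> R) :
  (forall j, f j k @[k --> G] --> a j) ->
  \sum_j f j k @[k --> G] --> \sum_j a j.
Proof. by move=> fa; apply: cvg_big => //; exact: add_continuous. Qed.

Lemma cvg_prod_fin (J : finType) (f : J -> nat -> R) (a : J -> R) :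
  (forall j, f j k @[k --> G] --> a j) ->
  \prod_j f j k @[k --> G] --> \prod_j a j.
Proof. by move=> fa; apply: cvg_big => //; exact: mul_continuous. Qed.

Lemma cvg_exprn (f : nat -> R) (a : R) m :
  f k @[k --> G] --> a -> f k ^+ m @[k --> G] --> a ^+ m.
Proof. by move=> fa; apply: (@continuous_cvg _ _ _ _ _ f (fun x : R => x ^+ m) a) => //; exact: exprn_continuous. Qed.

Lemma cvg_harmonic_sub : \oo `<=` G -> (@harmonic R) k @[k --> G] --> 0.
Proof. by move=> ooG; apply: cvg_trans (@cvg_harmonic R) => A; exact: ooG. Qed.

End Cvg.

Lemma ultra_simplex_cvg (R : realType) (G : set_system nat) (I : finType)
    (u : nat -> I -> R) : UltraFilter G ->
  (forall k j, 0 <= u k j) -> (forall k, \sum_j u k j = 1) ->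
  exists x : I -> R, [/\ forall j, 0 <= x j, \sum_j x j = 1 &
    forall j, u k j @[k --> G] --> x j].
Proof.
move=> GU u0 u1.
have /choice[x xP] j : exists l : R, 0 <= l /\ u k j @[k --> G] --> l.
  have [|l /andP[l0 _] ul] := @ultra_bounded_cvg R G (fun k => u k j) 0 1 GU; last by exists l.
  by move=> k; rewrite u0 (sum1_le1 j (u0 k)).
have ux j : u k j @[k --> G] --> x j by case: (xP j).
exists x; split=> // [j|]; first by case: (xP j).
have /cvg_unique : \sum_j u k j @[k --> G] --> \sum_j x j by exact: cvg_sum_fin.
by apply; [exact: norm_hausdorff|rewrite (funext u1); exact: cvg_cst].
Qed.

Lemma ex_exprn_root (R : realType) (a : R) (m : nat) :
  0 < a -> (0 < m)%N -> exists2 y, 0 < y & y ^+ m = a.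
Proof.
move=> a0 m0; exists (a `^ m%:R^-1); first exact: powR_gt0.
by rewrite -powR_mulrn ?powR_ge0// -powRrM mulVf ?powRr1 ?pnatr_eq0 -?lt0n// ltW.
Qed.

(** * Homogeneous monotone maps and the Collatz-Wielandt number *)

(** This abstraction lets one Perron argument serve twice: for the map of a tensor, and in degree 1
    for stationary weights. Continuity is stated along filters on [nat], the form in which the
    ultrafilter limits use it. *)
Record homogeneous_monotone (R : realType) (I : finType) (m : nat)
    (F : (I -> R) -> I -> R) : Prop := HomogeneousMonotone {
  hm_ge0 : forall x, (forall j, 0 <= x j) -> forall i, 0 <= F x i;
  hm_le : forall x y, (forall j, 0 <= x j) -> (forall j, x j <= y j) ->
    forall i, F x i <= F y i;
  hm_scale : forall c x i, F (fun j => c * x j) i = c ^+ m * F x i;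
  hm_cvg : forall (G : set_system nat), ProperFilter G ->
    forall (u : nat -> I -> R) (v : I -> R),
    (forall j, u k j @[k --> G] --> v j) -> forall i, F (u k) i @[k --> G] --> F v i
}.

(* The infimum of this set is the Collatz-Wielandt number. *)
Definition superradii (R : realType) (I : finType) (m : nat)
    (F : (I -> R) -> I -> R) : set R :=
  [set r | exists2 x : I -> R, forall i, 0 < x i & forall i, F x i <= r * x i ^+ m].

Definition perturb (R : realType) (I : finType) (m : nat)
    (F : (I -> R) -> I -> R) (e : R) (x : I -> R) (i : I) : R :=
  F x i + e * (\sum_j x j) ^+ m.

Section Collatz.
Context {R : realType} {I : finType} (i0 : I) (m : nat) (m0 : (0 < m)%N).
Implicit Types (F : (I -> R) -> I -> R) (x : I -> R).

Lemma superradii_normalized F r : homogeneous_monotone m F -> superradii m F r ->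
  exists x, [/\ forall i, 0 < x i, \sum_i x i = 1 & forall i, F x i <= r * x i ^+ m].
Proof.
move=> hF [x x0 Fx]; have s0 : 0 < \sum_i x i.
  by rewrite (bigD1 i0)//= ltr_pwDl// sumr_ge0// => i _; exact: ltW.
exists (fun i => (\sum_j x j)^-1 * x i); split.
- by move=> i; rewrite mulr_gt0 ?invr_gt0.
- by rewrite -mulr_sumr mulVf// gt_eqF.
- by move=> i; rewrite (hm_scale hF) exprMn mulrCA ler_pM2l ?exprn_gt0 ?invr_gt0.
Qed.

Lemma superradii_ge0 F : homogeneous_monotone m F -> lbound (superradii m F) 0.
Proof.
move=> hF r [x x0 Fx]; rewrite -(pmulr_lge0 _ (exprn_gt0 m (x0 i0))).
by apply: le_trans (Fx i0); apply: (hm_ge0 hF) => j; exact: ltW.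
Qed.

Lemma superradii_has_inf F : homogeneous_monotone m F -> has_inf (superradii m F).
Proof.
move=> hF; split; last by exists 0; exact: superradii_ge0.
have F1 j : 0 <= F (fun=> 1) j by apply: (hm_ge0 hF).
exists (\sum_i F (fun=> 1) i); exists (fun=> 1) => // i.
by rewrite expr1n mulr1 (bigD1 i)//= lerDl sumr_ge0.
Qed.

Lemma perturb_homogeneous_monotone F e : 0 <= e -> homogeneous_monotone m F ->
  homogeneous_monotone m (perturb m F e).
Proof.
move=> e0 hF; split; rewrite /perturb.
- move=> x x0 i; rewrite addr_ge0 ?(hm_ge0 hF)// mulr_ge0// exprn_ge0// sumr_ge0//.
- move=> x y x0 xy i; rewrite lerD ?(hm_le hF)// ler_wpM2l// lerXn2r ?nnegrE ?ler_sum//;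
    rewrite sumr_ge0// => j _; exact: le_trans (xy j).
- by move=> c x i; rewrite (hm_scale hF) -mulr_sumr exprMn; ring.
- move=> G FG u v uv i; apply: cvgD; first exact: (hm_cvg hF).
  by apply: cvgMr; apply: cvg_exprn; exact: cvg_sum_fin.
Qed.

(** Strictness comes from the added term alone, which sees every coordinate through the sum; hence
    it holds at each [i], wherever the strict increase occurs. *)
Lemma perturb_lt F e x y i : 0 < e -> homogeneous_monotone m F ->
  (forall j, 0 <= x j) -> (forall j, x j <= y j) -> (exists j, x j < y j) ->
  perturb m F e x i < perturb m F e y i.
Proof.
move=> e0 hF x0 xy [j xyj]; rewrite ler_ltD ?(hm_le hF)// ltr_pM2l//.
rewrite ltrXn2r ?sumr_ge0 -?lt0n//.
by rewrite (bigD1 j)//= [ltRHS](bigD1 j)//= ltr_leD// ler_sum.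
Qed.

Lemma superradii_lt F r y : homogeneous_monotone m F -> (forall i, 0 < y i) ->
  (forall i, F y i < r * y i ^+ m) -> exists2 s, superradii m F s & s < r.
Proof.
move=> hF y0 Fy; have y0m i : 0 < y i ^+ m by rewrite exprn_gt0.
exists (\big[Num.max/0]_i (F y i / y i ^+ m)).
  by exists y => // i; rewrite -ler_pdivrMr// le_bigmax.
(* The maximum has default value [0], so [0 < r] must be checked as well; the hypothesis at [i0]
   gives it. *)
apply: bigmax_lt => [|i _]; last by rewrite ltr_pdivrMr.
rewrite -(pmulr_lgt0 _ (y0m i0)); apply: le_lt_trans (Fy i0).
by apply: (hm_ge0 hF) => j; exact: ltW.
Qed.

(* The infimum over positive vectors is attained because the perturbation keeps
   every coordinate of a limit of minimising vectors away from [0].  If the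
   minimiser [x] is not an eigenvector, then strict monotonicity makes the
   coordinatewise [m]-th root of its image strictly better. *)
Lemma perturb_eigenvector F e : 0 < e -> homogeneous_monotone m F ->
  exists x r, [/\ forall i, 0 < x i, \sum_i x i = 1 &
    forall i, perturb m F e x i = r * x i ^+ m] /\
    (superradii m (perturb m F e) r /\ lbound (superradii m (perturb m F e)) r).
Proof.
move=> e0 hF0; set F' := perturb m F e.
have hF : homogeneous_monotone m F' by apply: perturb_homogeneous_monotone => //; exact: ltW.
have hinf := superradii_has_inf hF; set r := inf (superradii m F').
have rlb : lbound (superradii m F') r by apply: ge_inf; case: hinf.
have /choice[u uP] k : exists x : I -> R, [/\ forall i, 0 < x i, \sum_i x i = 1 &
    forall i, F' x i <= (r + harmonic k) * x i ^+ m].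
  have [s Ss sr] := inf_adherent (harmonic_gt0 k) hinf.
  have [x [x0 x1 Fx]] := superradii_normalized hF Ss; exists x; split=> // i.
  by rewrite (le_trans (Fx i))// ler_pM2r ?exprn_gt0// ltW.
have [G GU ooG] := ultra_oo.
have [||x [x0 x1 ux]] := @ultra_simplex_cvg R G I u GU.
- by move=> k j; have [u0 _ _] := uP k; exact: ltW.
- by move=> k; have [_ u1 _] := uP k.
have Fx i : F' x i <= r * x i ^+ m.
  apply: (@ler_cvg_to _ G _ R (fun k => F' (u k) i) (fun k => (r + harmonic k) * u k i ^+ m)).
  - exact: (hm_cvg hF).
  - apply: cvgM; last exact: cvg_exprn.
    by rewrite -[r in X in _ --> X]addr0; apply: cvgD; [exact: cvg_cst|exact: cvg_harmonic_sub].
  - by apply: nearW => k; case: (uP k).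
have Fx0 i : 0 < F' x i.
  by rewrite /F' /perturb x1 expr1n mulr1 ltr_wpDl// (hm_ge0 hF0).
have r0 : 0 <= r by apply: lb_le_inf; [case: hinf|exact: superradii_ge0].
have xpos i : 0 < x i.
  rewrite lt_neqAle x0 andbT; apply/eqP => xi.
  by have := lt_le_trans (Fx0 i) (Fx i); rewrite -xi expr0n gtn_eqF// mulr0 ltxx.
have Sr : superradii m F' r by exists x.
exists x, r; split => //; split=> // i; apply/eqP; rewrite eq_le Fx/= leNgt; apply/negP => Fxi.
have r0' : 0 < r by rewrite -(pmulr_lgt0 _ (exprn_gt0 m (xpos i))) (lt_le_trans (Fx0 i)).
(* With [c ^+ m = r] and [y] the root of the image of [x], [y <= c * x] holds everywhere and
   strictly at [i]. So [F' y] is strictly below [F' (c * x) = r * F' x = r * y ^+ m] in every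
   coordinate, against the minimality of [r]. *)
have [c c0 cm] := ex_exprn_root r0' m0.
have /choice[y yP] j : exists z, 0 < z /\ z ^+ m = F' x j.
  by have [z] := ex_exprn_root (Fx0 j) m0; exists z.
have y0 j : 0 < y j by case: (yP j).
have ym j : y j ^+ m = F' x j by case: (yP j).
have ycx j : y j <= c * x j.
  have cx0 : 0 <= c * x j by rewrite mulr_ge0// ltW.
  by rewrite -(ler_pXn2r m0) ?nnegrE ?(ltW (y0 j))// ym exprMn cm Fx.
have [|s /rlb rs] := @superradii_lt F' r y hF y0; last by rewrite ltNge rs.
move=> j; rewrite ym -cm -(hm_scale hF); apply: perturb_lt => //.
  by move=> k; exact: ltW.
exists i; rewrite lt_neqAle ycx andbT; apply/eqP => yi.
by move: Fxi; rewrite -ym yi exprMn cm ltxx.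
Qed.

End Collatz.

(** * Eigenvectors without perturbation *)

Section Perron.
Context {R : realType} {I : finType} (i0 : I) (m : nat) (m0 : (0 < m)%N).
Implicit Types (F : (I -> R) -> I -> R) (x : I -> R).

Lemma superradii_perturb F e : 0 <= e ->
  superradii m (perturb m F e) `<=` superradii m F.
Proof.
move=> e0 r [x x0 Fx]; exists x => // i; apply: le_trans (Fx i).
by rewrite lerDl mulr_ge0// exprn_ge0// sumr_ge0// => j _; exact: ltW.
Qed.

(** Take an eigenvector of a perturbation so small that a nearly optimal [y] for [F] remains nearly
    optimal. This confines the perturbed eigenvalue to the interval from [rho] to [rho + d + d]. *)
Lemma ex_approx_eigenvector F d : 0 < d -> homogeneous_monotone m F ->
  let rho := inf (superradii m F) in
  exists x, [/\ forall i, 0 <= x i, \sum_i x i = 1 & forall i,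
    rho * x i ^+ m - d <= F x i <= (rho + d + d) * x i ^+ m].
Proof.
move=> d0 hF rho; have hinf := superradii_has_inf i0 hF.
have [s Ss sr] := inf_adherent d0 hinf.
have [y [y0 y1 Fy]] := superradii_normalized i0 hF Ss.
have y01 j : 0 <= y j ^+ m <= 1.
  rewrite exprn_ge0 ?(ltW (y0 j))//= exprn_ile1 ?(ltW (y0 j))// -y1 (bigD1 j)//= lerDl.
  by rewrite sumr_ge0// => i _; exact: ltW.
(* All factors are at most 1, so the product is a positive lower bound for each of them and
   [e <= d * y i ^+ m] for every [i]. *)
set e := d * \prod_j y j ^+ m.
have e0 : 0 < e by rewrite mulr_gt0// prodr_gt0// => j _; rewrite exprn_gt0.
have ey i : e <= d * y i ^+ m.
  rewrite ler_pM2l// (bigD1 i)//= ler_piMr ?exprn_ge0 ?(ltW (y0 i))//.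
  by rewrite prodr_ile1// => j _; exact: y01.
have [x [r [[x0 x1 Fx] [Sr rlb]]]] := perturb_eigenvector i0 m0 e0 hF.
have rho_r : rho <= r.
  by apply: ge_inf; [case: hinf|exact: superradii_perturb (ltW e0) _ Sr].
have r_rho : r <= rho + d + d.
  apply: rlb; exists y => // i; rewrite /perturb y1 expr1n mulr1 mulrDl lerD//.
  by rewrite (le_trans (Fy i))// ler_wpM2r ?(ltW sr)//; case/andP: (y01 i).
exists x; split=> // [i|i]; first exact: ltW.
have xm : 0 <= x i ^+ m by rewrite exprn_ge0// ltW.
have ed : e <= d by rewrite (le_trans (ey i0))// ler_piMr ?(ltW d0)//; case/andP: (y01 i0).
have := Fx i; rewrite /perturb x1 expr1n mulr1 => Fxi.
have rl := ler_wpM2r xm rho_r; have ru := ler_wpM2r xm r_rho.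
apply/andP; split; lra.
Qed.

(** The two approximate inequalities close up in the limit. The normalisation survives, so the limit
    is nonzero, though some coordinates may vanish. *)
Lemma ex_nonneg_eigenvector F : homogeneous_monotone m F ->
  exists x, [/\ forall i, 0 <= x i, \sum_i x i = 1 &
    forall i, F x i = inf (superradii m F) * x i ^+ m].
Proof.
move=> hF; set rho := inf _.
have /choice[u uP] k := ex_approx_eigenvector (harmonic_gt0 k) hF.
have [G GU ooG] := ultra_oo.
have [||x [x0 x1 ux]] := @ultra_simplex_cvg R G I u GU.
- by move=> k j; have [u0 _ _] := uP k.
- by move=> k; have [_ u1 _] := uP k.
have h0 : (@harmonic R) k @[k --> G] --> 0 by exact: cvg_harmonic_sub.
exists x; split=> // i.
have uxm : u k i ^+ m @[k --> G] --> x i ^+ m by apply: cvg_exprn; exact: ux.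
have Fu : F (u k) i @[k --> G] --> F x i by exact: (hm_cvg hF).
apply/eqP; rewrite eq_le; apply/andP; split.
  apply: (@ler_cvg_to _ G _ R (fun k => F (u k) i)
    (fun k => (rho + harmonic k + harmonic k) * u k i ^+ m)) => //.
  - rewrite -[rho in X in _ --> X]addr0 -[rho in X in _ --> X]addr0.
    by apply: cvgM => //; do 2![apply: cvgD => //]; exact: cvg_cst.
  - by apply: nearW => k; have [_ _ /(_ i)/andP[]] := uP k.
apply: (@ler_cvg_to _ G _ R (fun k => rho * u k i ^+ m - harmonic k) (fun k => F (u k) i)) => //.
- by rewrite -[X in _ --> X]subr0; apply: cvgB => //; exact: cvgMr.
- by apply: nearW => k; have [_ _ /(_ i)/andP[]] := uP k.
Qed.

End Perron.

(** * Stationary weights and Jensen's inequality for the logarithm *)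

Lemma ex_stationary_vector (R : realType) (I : finType) (i0 : I) (a : I -> I -> R) (c : R) :
  (forall i j, 0 <= a i j) -> (forall i, \sum_j a i j = c) ->
  exists p : I -> R, [/\ forall i, 0 <= p i, \sum_i p i = 1 &
    forall j, \sum_i p i * a i j = c * p j].
Proof.
move=> a0 ac; pose F (p : I -> R) j := \sum_i p i * a i j.
have hF : homogeneous_monotone 1 F.
  split; rewrite /F.
  - by move=> x x0 j; apply: sumr_ge0 => i _; exact: mulr_ge0.
  - by move=> x y x0 xy j; apply: ler_sum => i _; exact: ler_wpM2r.
  - by move=> b x j; rewrite expr1 mulr_sumr; apply: eq_bigr => i _; rewrite mulrA.
  - by move=> G FG u v uv j; apply: cvg_sum_fin => i; exact: cvgMl.
have [p [p0 p1 Fp]] := ex_nonneg_eigenvector i0 (ltnSn 0) hF.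
exists p; split=> // j; rewrite -/(F p j) Fp expr1; congr (_ * _).
(* The eigenvalue is found by summing the coordinates of [F p]: constant row sums make the total
   [c]. *)
transitivity (\sum_j F p j).
  by under eq_bigr => k _ do rewrite Fp expr1; rewrite -mulr_sumr p1 mulr1.
rewrite exchange_big/=; under eq_bigr => i _ do rewrite -mulr_sumr ac.
by rewrite -mulr_suml p1 mul1r.
Qed.

(** The tangent of [ln] at the mean [S] gives [ln (z j) <= ln S + (z j / S - 1)], and the correction
    averages to 0. *)
Lemma ln_jensen (R : realType) (J : finType) (w z : J -> R) :
  (forall j, 0 <= w j) -> \sum_j w j = 1 -> (forall j, 0 < z j) ->
  \sum_j w j * ln (z j) <= ln (\sum_j w j * z j).
Proof.
move=> w0 w1 z0; set S := \sum_j w j * z j.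
have S0 : 0 < S.
  have [|j /=] := @psumr_neq0P _ _ predT w (fun j _ => w0 j).
    by rewrite w1; apply/eqP; rewrite oner_eq0.
  by move=> wj; rewrite /S (bigD1 j)//= ltr_pwDl ?mulr_gt0// sumr_ge0// => k _; rewrite mulr_ge0// ltW.
have lnz j : ln (z j) <= ln S + (z j / S - 1).
  have zS : -1 < z j / S - 1 by rewrite ltrBrDl subrr divr_gt0.
  by have := le_ln1Dx zS; rewrite [1 + _]addrC subrK ln_div ?posrE// lerBlDl.
apply: (@le_trans _ _ (\sum_j w j * (ln S + (z j / S - 1)))).
  by apply: ler_sum => j _; rewrite ler_wpM2l.
under eq_bigr => j _ do rewrite mulrDr mulrBr mulr1 mulrA.
rewrite big_split/= sumrB -!mulr_suml w1 mul1r.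
by rewrite -/S divff ?gt_eqF// subrr addr0.
Qed.

Lemma ln_prod (R : realType) (J : finType) (z : J -> R) :
  (forall j, 0 < z j) -> ln (\prod_j z j) = \sum_j ln (z j).
Proof.
move=> z0; suff [] : 0 < \prod_j z j /\ ln (\prod_j z j) = \sum_j ln (z j) by [].
elim/big_rec2 : _ => [|j s p _ [p0 <-]]; first by rewrite ln1.
by rewrite lnM ?posrE ?mulr_gt0.
Qed.

(** * Tensor maps and the tangent inequality in logarithmic coordinates *)

Definition tensor_map (R : realType) (I J : finType) (T : I -> {ffun J -> I} -> R)
    (x : I -> R) (i : I) : R :=
  \sum_(f : {ffun J -> I}) T i f * \prod_k x (f k).

Section TensorMap.
Context {R : realType} {I J : finType} (i0 : I).
Implicit Types (T : I -> {ffun J -> I} -> R) (x v : I -> R).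

Lemma tensor_map_homogeneous_monotone T : (forall i f, 0 <= T i f) ->
  homogeneous_monotone #|J| (tensor_map T).
Proof.
move=> T0; split; rewrite /tensor_map.
- by move=> x x0 i; apply: sumr_ge0 => f _; rewrite mulr_ge0// prodr_ge0.
- move=> x y x0 xy i; apply: ler_sum => f _; rewrite ler_wpM2l// ler_prod// => k _.
  by rewrite x0 xy.
- move=> c x i; rewrite mulr_sumr; apply: eq_bigr => f _.
  by rewrite big_split/= prodr_const cardT -cardE; ring.
- move=> G FG u v uv i; apply: cvg_sum_fin => f; apply: cvgMr.
  exact: cvg_prod_fin.
Qed.

(** Expanding the power of the sum over all functions from [J] to [I] yields the all-ones tensor, so
    the perturbed map is again a tensor map. *)
Lemma tensor_map_perturb T e x i :
  tensor_map (fun i f => T i f + e) x i = perturb #|J| (tensor_map T) e x i.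
Proof.
rewrite /tensor_map /perturb; under eq_bigr => f _ do rewrite mulrDl.
rewrite big_split/= -mulr_sumr; congr (_ + _ * _).
by rewrite -prodr_const bigA_distr_bigA.
Qed.

(* Let [a i j] be the logarithmic derivative of [tensor_map T x i] with respect
   to [x j] at [v]; its rows sum to [#|J|].  The tangent inequality below follows
   from Jensen, and averaging it over a stationary vector of [a] makes its linear
   part vanish. *)
Lemma ex_log_growth_bound T v r : (forall i f, 0 <= T i f) -> (forall i, 0 < v i) ->
  0 < r -> (forall i, tensor_map T v i = r * v i ^+ #|J|) ->
  exists p : I -> R, [/\ forall i, 0 <= p i, \sum_i p i = 1 &
    forall x, (forall i, 0 < x i) ->
      ln r <= \sum_i p i * ln (tensor_map T x i / x i ^+ #|J|)].
Proof.
move=> T0 v0 r0 Tv; pose h i := r * v i ^+ #|J|.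
have h0 i : 0 < h i by rewrite mulr_gt0 ?exprn_gt0.
(* [w i f] is the share of the monomial [f] in [tensor_map T v i]; the eigenvector equation makes
   the shares sum to 1. Below, [a i j] is the mean number of occurrences of [j] in a monomial under
   these shares. *)
pose w i (f : {ffun J -> I}) := T i f * (\prod_k v (f k)) / h i.
have w0 i f : 0 <= w i f.
  by rewrite divr_ge0 ?(ltW (h0 i))// mulr_ge0// prodr_ge0// => k _; exact: ltW.
have w1 i : \sum_f w i f = 1.
  by rewrite -mulr_suml -/(tensor_map T v i) Tv divff// gt_eqF//; exact: h0.
pose a i j := \sum_f w i f * \sum_k (f k == j)%:R.
have a_sum i (g : I -> R) : \sum_j a i j * g j = \sum_f w i f * \sum_k g (f k).
  under eq_bigr => j _ do rewrite mulr_suml.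
  rewrite exchange_big/=; apply: eq_bigr => f _.
  under eq_bigr => j _ do rewrite -mulrA mulr_suml.
  rewrite -mulr_sumr exchange_big/=; congr (_ * _); apply: eq_bigr => k _.
  rewrite (bigD1 (f k))//= eqxx mul1r big1 ?addr0// => j.
  by rewrite eq_sym => /negPf ->; rewrite mul0r.
have a0 i j : 0 <= a i j.
  by apply: sumr_ge0 => f _; rewrite mulr_ge0// sumr_ge0// => k _; exact: ler0n.
have am i : \sum_j a i j = #|J|%:R.
  have := a_sum i (fun=> 1); under eq_bigr => j _ do rewrite mulr1.
  by move=> ->; rewrite -mulr_suml w1 mul1r sumr_const cardT -cardE.
have [p [p0 p1 pa]] := ex_stationary_vector i0 a0 am.
exists p; split=> // x x0.
have z0 j : 0 < x j / v j by rewrite divr_gt0.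
have Tx i : tensor_map T x i = h i * \sum_f w i f * \prod_k (x (f k) / v (f k)).
  rewrite mulr_sumr; apply: eq_bigr => f _.
  rewrite big_split/= prodfV /w.
  have : \prod_k v (f k) != 0 by rewrite gt_eqF// prodr_gt0.
  have := gt_eqF (h0 i); move: (h i) (\prod_k v (f k)) => c b c0 b0.
  by field; rewrite b0 c0.
have zf (f : {ffun J -> I}) : 0 < \prod_k (x (f k) / v (f k)) by rewrite prodr_gt0.
have S0 i : 0 < \sum_f w i f * \prod_k (x (f k) / v (f k)).
  have [|f /= wf] := @psumr_neq0P _ _ predT (w i) (fun j _ => w0 i j).
    by rewrite w1; apply/eqP; rewrite oner_eq0.
  rewrite (bigD1 f)//= ltr_pwDl ?(mulr_gt0 wf (zf f))// sumr_ge0// => k _; rewrite mulr_ge0//.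
  exact: ltW.
have tangent i : ln (h i) + \sum_j a i j * ln (x j / v j) <= ln (tensor_map T x i).
  rewrite Tx [leRHS]lnM ?posrE// lerD2l (le_trans _ (ln_jensen (w0 i) (w1 i) zf))//.
  by rewrite a_sum ler_sum// => f _; rewrite ln_prod.
have Tx0 i : 0 < tensor_map T x i by rewrite Tx mulr_gt0.
apply: (@le_trans _ _ (\sum_i p i * (ln (h i) + \sum_j a i j * ln (x j / v j) - #|J|%:R * ln (x i)))).
  pose g i := ln (x i / v i).
  (* In terms of [g], the summand is [ln r] plus a part linear in [g], which cancels after summation
     because [p] is stationary for [a]. *)
  have lin i : p i * (ln (h i) + \sum_j a i j * ln (x j / v j) - #|J|%:R * ln (x i)) =
      p i * ln r - #|J|%:R * p i * g i + \sum_j p i * a i j * g j.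
    have -> : ln (h i) = ln r + #|J|%:R * ln (v i).
      by rewrite lnM ?posrE ?exprn_gt0// lnXn// mulr_natl.
    have -> : g i = ln (x i) - ln (v i) by rewrite /g ln_div ?posrE.
    under [in RHS]eq_bigr => j _ do rewrite -mulrA.
    by rewrite -mulr_sumr; ring.
  under eq_bigr => i _ do rewrite lin.
  rewrite big_split/= sumrB exchange_big/= -mulr_suml p1 mul1r.
  under [X in _ <= _ + X]eq_bigr => j _ do rewrite -mulr_suml pa.
  by rewrite subrK.
apply: ler_sum => i _; rewrite ler_wpM2l// ln_div ?posrE ?exprn_gt0// lnXn// mulr_natl lerD2r.
exact: tangent.
Qed.
End TensorMap.

(** * Continuity of real powers *)

Section CvgPowR.
Context {R : realType} {G : set_system nat} {FG : ProperFilter G}.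

Lemma cvg_powR_exponent (a : R) (u : nat -> R) (l : R) : 0 < a ->
  u k @[k --> G] --> l -> a `^ u k @[k --> G] --> a `^ l.
Proof.
move=> a0 ul; rewrite /powR gt_eqF//.
apply: (@continuous_cvg _ _ _ _ _ (fun k => u k * ln a) (@expR R)).
  exact: continuous_expR.
exact: cvgMl.
Qed.

Lemma cvg_powR_base (p : R) (u : nat -> R) (l : R) : 0 <= p -> 0 <= l ->
  (forall k, 0 <= u k) -> u k @[k --> G] --> l -> u k `^ p @[k --> G] --> l `^ p.
Proof.
rewrite le_eqVlt => /predU1P[<- _ _ _|p0].
  by rewrite powRr0; under eq_fun do rewrite powRr0; exact: cvg_cst.
rewrite le_eqVlt => /predU1P[<- u0 ul|l0 u0 ul].
  rewrite powR0 ?gt_eqF//; apply/cvgr0Pnorm_le => e e0.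
  have ep : 0 < e `^ p^-1 by exact: powR_gt0.
  move/cvgr0Pnorm_le : ul => /(_ _ ep); apply: filterS => k.
  rewrite !ger0_norm ?powR_ge0// => uk.
  rewrite (le_trans (ge0_ler_powR (ltW p0) _ _ uk)) ?nnegrE ?powR_ge0//.
  by rewrite -powRrM mulVf ?gt_eqF// powRr1// ltW.
apply: (@continuous_cvg _ _ _ _ _ u (fun a => a `^ p)) => //.
apply: differentiable_continuous; apply/derivable1_diffP.
by apply: derivable_powR; rewrite in_itv/= l0.
Qed.

End CvgPowR.

(** * Weights that are optimal for the unperturbed map *)

Section Minimax.
Context {R : realType} {I J : finType} (i0 : I) (J0 : (0 < #|J|)%N).
Variables (T : I -> {ffun J -> I} -> R) (T0 : forall i f, 0 <= T i f).
Let rho := inf (superradii #|J| (tensor_map T)).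

(** The perturbed eigenvalue is at least [rho], since perturbing shrinks the set of superradii; the
    logarithmic bound is then exponentiated. *)
Lemma ex_perturbed_growth_bound e : 0 < e ->
  exists p : I -> R, [/\ forall i, 0 <= p i, \sum_i p i = 1 &
    forall x, (forall i, 0 < x i) ->
      rho <= \prod_i (perturb #|J| (tensor_map T) e x i / x i ^+ #|J|) `^ p i].
Proof.
move=> e0; have hF := tensor_map_homogeneous_monotone T0.
have [v [r [[v0 v1 Fv] [Sr _]]]] := perturb_eigenvector i0 J0 e0 hF.
have Te0 i f : 0 <= T i f + e by rewrite addr_ge0// ltW.
have Tpos x i : (forall i, 0 < x i) -> 0 < perturb #|J| (tensor_map T) e x i.
  move=> x0; rewrite ltr_wpDl ?(hm_ge0 hF)//; first by move=> j; exact: ltW.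
  by rewrite mulr_gt0// exprn_gt0// (bigD1 i)//= ltr_pwDl// sumr_ge0// => j _; exact: ltW.
have r0 : 0 < r by rewrite -(pmulr_lgt0 _ (exprn_gt0 #|J| (v0 i0))) -Fv Tpos.
have [|p [p0 p1 hp]] := @ex_log_growth_bound R I J i0 _ v r Te0 v0 r0.
  by move=> i; rewrite tensor_map_perturb.
exists p; split=> // x x0; apply: (@le_trans _ _ r).
  apply: ge_inf; first by case: (superradii_has_inf i0 hF).
  exact: superradii_perturb (ltW e0) _ Sr.
rewrite -[r]lnK ?posrE//.
rewrite (eq_bigr (fun i => expR (p i * ln (tensor_map (fun i f => T i f + e) x i / x i ^+ #|J|)))).
  by rewrite -expR_sum ler_expR hp.
move=> i _; rewrite tensor_map_perturb /powR gt_eqF// divr_gt0 ?exprn_gt0//.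
exact: Tpos.
Qed.

(** Two successive limits: first the weights converge while the perturbation, hence the positivity
    of the bases, is fixed; then the perturbation tends to 0 under the limit weights. *)
Lemma ex_optimal_weights : exists p : I -> R, [/\ forall i, 0 <= p i, \sum_i p i = 1 &
    forall x, (forall i, 0 < x i) ->
      rho <= \prod_i (tensor_map T x i / x i ^+ #|J|) `^ p i].
Proof.
have hF := tensor_map_homogeneous_monotone T0.
have /choice[u uP] k := ex_perturbed_growth_bound (harmonic_gt0 k).
have [G GU ooG] := ultra_oo.
have [||p [p0 p1 up]] := @ultra_simplex_cvg R G I u GU.
- by move=> k j; have [u0 _ _] := uP k.
- by move=> k; have [_ u1 _] := uP k.
have h0 : (@harmonic R) k @[k --> G] --> 0 by exact: cvg_harmonic_sub.
exists p; split=> // x x0.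
pose a e i := perturb #|J| (tensor_map T) e x i / x i ^+ #|J|.
have x0' i : 0 <= x i by exact: ltW.
have s0 : 0 < (\sum_j x j) ^+ #|J|.
  by rewrite exprn_gt0// (bigD1 i0)//= ltr_pwDl// sumr_ge0.
have a_gt0 e i : 0 < e -> 0 < a e i.
  move=> e0; rewrite divr_gt0 ?exprn_gt0// ltr_wpDl ?(hm_ge0 hF)//.
  by rewrite mulr_gt0.
(* Once [harmonic k <= e], monotonicity in the perturbation replaces the bases [a (harmonic k) i] by
   [a e i]. *)
have fixed_e e : 0 < e -> rho <= \prod_i a e i `^ p i.
  move=> e0; apply: (@cvgr_to_ge _ G _ R (fun k => \prod_i a e i `^ u k i)).
    by apply: cvg_prod_fin => i; apply: cvg_powR_exponent => //; exact: a_gt0.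
  have : \forall k \near G, harmonic k <= e by apply: cvgr_le h0 _ e0.
  apply: filterS => k ke; have [uk0 _ /(_ x x0) uk] := uP k.
  apply: (le_trans uk); apply: ler_prod => i _; rewrite powR_ge0/=.
  apply: ge0_ler_powR => //; rewrite ?nnegrE.
  - by apply/ltW/a_gt0; exact: harmonic_gt0.
  - exact/ltW/a_gt0.
  by rewrite ler_wpM2r ?invr_ge0 ?exprn_ge0// lerD2l ler_wpM2r// ltW.
have aE i : tensor_map T x i / x i ^+ #|J| = a 0 i.
  by rewrite /a /perturb mul0r addr0.
under eq_bigr => i _ do rewrite aE.
apply: (@cvgr_to_ge _ G _ R (fun k => \prod_i a (harmonic k) i `^ p i)); last first.
  by apply: nearW => k; apply: fixed_e; exact: harmonic_gt0.
apply: cvg_prod_fin => i; apply: cvg_powR_base.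
- exact: p0.
- by rewrite -aE divr_ge0 ?exprn_ge0// (hm_ge0 hF).
- by move=> k; apply/ltW/a_gt0; exact: harmonic_gt0.
- apply: cvgMl; apply: cvgD; first exact: cvg_cst.
  exact: cvgMl.
Qed.

End Minimax.

(** * Bounds on the moduli of eigenvalues *)

(** Let [c] be the largest ratio [u i / x i]. Then [u <= c * x], and at a maximising [i]
    monotonicity and homogeneity give [r * u i ^+ m <= s * (c * x i) ^+ m = s * u i ^+ m]. *)
Lemma subradius_le_superradius (R : realType) (I : finType) (m : nat)
    (F : (I -> R) -> I -> R) (u : I -> R) (r s : R) :
  homogeneous_monotone m F -> (forall i, 0 <= u i) -> (exists i, 0 < u i) ->
  (forall i, r * u i ^+ m <= F u i) -> superradii m F s -> r <= s.
Proof.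
move=> hF u0 [i1 ui1] Fu [x x0 Fx].
have [i _ imax] := @arg_maxP _ _ _ i1 predT (fun i => u i / x i) isT.
have ci : 0 < u i / x i by apply: lt_le_trans (imax i1 isT); rewrite divr_gt0.
have ui : 0 < u i by move: ci; rewrite pmulr_lgt0 ?invr_gt0.
rewrite -(ler_pM2r (exprn_gt0 m ui)); apply: le_trans (Fu i) _.
have ux j : u j <= u i / x i * x j by rewrite -ler_pdivrMr//; exact: imax.
apply: le_trans (hm_le hF u0 ux i) _; rewrite (hm_scale hF).
apply: (le_trans (ler_wpM2l (exprn_ge0 m (ltW ci)) (Fx i))).
by rewrite mulrCA -exprMn divfK// gt_eqF.
Qed.

Section TensorEigenvalue.
Context {R : realType} {n d : nat}.
Variables (T : tensor R n d) (T0 : nonneg_tensor T).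

Lemma tensor_applyE (x : 'cV[R]_n) i :
  tensor_apply T x i 0 = tensor_map T (fun j => x j 0) i.
Proof. by rewrite mxE. Qed.

(** By the triangle inequality, the moduli [u] of an eigenvector satisfy
    [r * u i ^+ d.-1 <= tensor_map T u i]. *)
Lemma eigenvalue_le_superradius l r s : tensor_eigenvalue T l -> `|l| = (r%:C)%C ->
  superradii d.-1 (tensor_map T) s -> r <= s.
Proof.
move=> [z z0 Tz] lr.
have hF := tensor_map_homogeneous_monotone T0; rewrite card_ord in hF.
pose u j := complex.Re `|z j 0|.
have uE j : `|z j 0| = ((u j)%:C)%C by rewrite /u normc_def.
apply: (subradius_le_superradius (u := u) hF).
- by move=> j; rewrite -lecR -uE; exact: normr_ge0.
- apply/not_existsP => u0; case/negP: z0; apply/eqP/matrixP => j k.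
  rewrite ord1 mxE; apply/eqP; rewrite -normr_le0 uE lecR leNgt; apply/negP; exact: u0.
move=> i; rewrite -lecR rmorphM rmorphXn /= -lr -uE -normrX -normrM.
have -> : l * z i 0 ^+ d.-1 = tensor_apply (complex_tensor T) z i 0 by rewrite Tz !mxE.
rewrite mxE (le_trans (ler_norm_sum _ _ _))// /tensor_map rmorph_sum /= ler_sum// => f _.
rewrite normrM normr_prod rmorphM rmorph_prod /= ger0_norm ?ler0c//.
Qed.

Lemma real_tensor_eigenvalue (x : 'I_n -> R) r : (exists i, x i != 0) ->
  (forall i, tensor_map T x i = r * x i ^+ d.-1) -> tensor_eigenvalue T (r%:C)%C.
Proof.
move=> [i xi] Tx; exists (\col_j ((x j)%:C)%C).
  apply/eqP => /matrixP/(_ i 0); rewrite !mxE => /eqP.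
  by rewrite (fmorph_eq0 (real_complex R)) (negPf xi).
apply/matrixP => j k; rewrite !mxE -rmorphXn -rmorphM /= -Tx rmorph_sum /=.
apply: eq_bigr => f _; rewrite rmorphM rmorph_prod /=; congr (_ * _).
by apply: eq_bigr => h _; rewrite mxE.
Qed.

End TensorEigenvalue.

(** * Extended logarithms and the minimax formula *)

(** At [a = 0] the conventions agree: [0]^ 0 = 1[matches a zero weight times]-oo[, and]0 [^ p = 0]
    matches a positive weight times [-oo]. *)
Lemma lne_powR (R : realType) (a p : R) : 0 <= a -> 0 <= p ->
  lne (a `^ p)%:E = (p%:E * lne a%:E)%E.
Proof.
rewrite [0 <= p]le_eqVlt => a0 /predU1P[<-|p0]; first by rewrite powRr0 mul0e lne1.
move: a0; rewrite le_eqVlt => /predU1P[<-|a0].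
  by rewrite powR0 ?gt_eqF// !le0_lneNy// gt0_muleNy// lte_fin.
by rewrite !lne_EFin ?powR_gt0// ln_powR.
Qed.

Lemma lne_prod (R : realType) (I : finType) (a : I -> R) : (forall i, 0 <= a i) ->
  lne (\prod_i a i)%:E = (\sum_i lne (a i)%:E)%E.
Proof.
move=> a0; suff [] : 0 <= \prod_i a i /\ lne (\prod_i a i)%:E = (\sum_i lne (a i)%:E)%E by [].
elim/big_rec2 : _ => [|i s p _ [p0 <-]]; first by rewrite lne1.
split; first exact: mulr_ge0.
have := a0 i; rewrite le_eqVlt => /predU1P[<-|ai].
  by rewrite mul0r le0_lneNy.
move: p0; rewrite le_eqVlt => /predU1P[<-|p0].
  by rewrite mulr0 le0_lneNy// lne_EFin.
by rewrite !lne_EFin ?mulr_gt0// lnM.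
Qed.

Lemma log_growthE (R : realType) (n d : nat) (T : tensor R n d) (p x : 'cV[R]_n) :
  nonneg_tensor T -> (forall i, 0 <= p i 0) -> (forall i, 0 < x i 0) ->
  log_growth T p x =
  lne (\prod_i (tensor_map T (fun j => x j 0) i / x i 0 ^+ d.-1) `^ p i 0)%:E.
Proof.
move=> T0 p0 x0; rewrite lne_prod => [|i]; last exact: powR_ge0.
apply: eq_bigr => i _; rewrite lne_powR// -tensor_applyE// divr_ge0 ?exprn_ge0 ?(ltW (x0 i))//.
rewrite tensor_applyE (hm_ge0 (tensor_map_homogeneous_monotone T0))// => j; exact: ltW.
Qed.

(** At the vector witnessing [s], all ratios are at most [s], hence so is their weighted geometric
    mean. *)
Lemma inf_log_growth_le (R : realType) (n d : nat) (T : tensor R n d) (p : 'cV[R]_n) s :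
  nonneg_tensor T -> probability_vectors R n p -> superradii d.-1 (tensor_map T) s ->
  0 < s ->
  (ereal_inf [set log_growth T p x | x in positive_vectors R n] <= lne s%:E)%E.
Proof.
move=> T0 [p0 p1] [x x0 Tx] s0.
have hF := tensor_map_homogeneous_monotone T0.
pose y : 'cV[R]_n := \col_j x j.
have y0 j : 0 < y j 0 by rewrite mxE.
apply: (@le_trans _ _ (log_growth T p y)); first by apply: ereal_inf_lbound; exists y.
have yE : (fun j => y j 0) = x by apply/funext => j; rewrite mxE.
rewrite log_growthE// yE lee_lne ?in_itv/= ?lee_fin ?leey ?andbT ?(ltW s0)//; last first.
  by rewrite prodr_ge0// => i _; exact: powR_ge0.
have -> : s = \prod_i s `^ p i 0.
  by rewrite /powR gt_eqF// -expR_sum -mulr_suml p1 mul1r lnK ?posrE.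
apply: ler_prod => i _; rewrite powR_ge0/= ge0_ler_powR ?nnegrE ?mxE ?(ltW s0)//.
  by rewrite divr_ge0 ?exprn_ge0 ?(ltW (x0 i))// (hm_ge0 hF)// => j; exact: ltW.
by rewrite ler_pdivrMr ?exprn_gt0.
Qed.

Theorem theorem11 (R : realType) (n d : nat) (hn : (1 <= n)%N) (hd : (3 <= d)%N)
    (T : tensor R n d) (Tsym : partially_symmetric T) (Tge0 : nonneg_tensor T) :
  exists2 rho : R, is_spectral_radius T rho &
    is_max
      [set ereal_inf [set log_growth T p x | x in positive_vectors R n]
         | p in probability_vectors R n]
      (lne rho%:E).
Proof.
pose i0 := Ordinal hn.
have d0 : (0 < #|'I_d.-1|)%N by rewrite card_ord -subn1 subn_gt0 (leq_trans _ hd).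
have hF := tensor_map_homogeneous_monotone Tge0.
have hinf := superradii_has_inf i0 hF.
have [x [x0 x1 Fx]] := ex_nonneg_eigenvector i0 d0 hF.
have [p [p0 p1 hp]] := ex_optimal_weights i0 d0 Tge0.
rewrite card_ord in hF hinf Fx hp.
set rho := inf _ in Fx hp.
have rho0 : 0 <= rho by apply: lb_le_inf; [case: hinf|exact: superradii_ge0].
have upper q : probability_vectors R n q ->
    (ereal_inf [set log_growth T q x | x in positive_vectors R n] <= lne rho%:E)%E.
  (* Exponentiating first allows an approximation by [rho + e] even when [rho = 0], where the
     logarithm is [-oo]. *)
  move=> qP; rewrite -lee_expeR [leRHS]lneK ?in_itv/= ?lee_fin ?rho0 ?leey//.
  apply/lee_addgt0Pr => e e0; have [s Ss sr] := inf_adherent e0 hinf.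
  have Se : superradii d.-1 (tensor_map T) (rho + e).
    have [y y0 Ty] := Ss; exists y => // i; apply: le_trans (Ty i) _.
    by rewrite ler_wpM2r ?exprn_ge0// ltW.
  have e0' : 0 < rho + e by rewrite ltr_wpDl.
  apply: (@le_trans _ _ (expeR (lne (rho + e)%:E))).
    by rewrite lee_expeR; exact: inf_log_growth_le.
  by rewrite lneK ?in_itv/= ?lee_fin ?(ltW e0') ?leey.
exists rho.
- split.
    exists (rho%:C)%C; last by rewrite ger0_norm ?ler0c.
    apply: real_tensor_eigenvalue Fx.
    have [|i /= xi] := @psumr_neq0P _ _ predT x (fun i _ => x0 i).
      by rewrite x1; apply/eqP; rewrite oner_eq0.
    by exists i; rewrite gt_eqF.
  move=> r [l Tl lr]; apply: lb_le_inf; first by case: hinf.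
  by move=> s; exact: eigenvalue_le_superradius Tl lr.
- split; last by move=> _ [q qP <-]; exact: upper.
  pose q : 'cV[R]_n := \col_j p j.
  have qP : probability_vectors R n q.
    split; first by move=> i; rewrite mxE.
    by under eq_bigr => i _ do rewrite mxE.
  (* The optimal weights give the reverse inequality, so the upper bound is attained at [q]. *)
  exists q => //; apply: le_anti; rewrite upper// andTb.
  apply: le_ereal_inf_tmp => _ [y y0 <-].
  rewrite log_growthE//; last by case: qP.
  rewrite lee_lne ?in_itv/= ?lee_fin ?leey ?andbT//; last first.
    by rewrite prodr_ge0// => i _; exact: powR_ge0.
  apply: le_trans (hp _ y0) _; rewrite le_eqVlt; apply/orP; left; apply/eqP.
  by apply: eq_bigr => i _; rewrite mxE.
Qed.
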